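(* Let $n$ be an integer with $8\le n<\infty$, and let $A=\mathrm{IDD}(K^1_n,-1,-1)$ be the complex algebra with basis $e_1,\ldots,e_n$ and bilinear multiplication $e_i\diamond e_j=\frac{1}{(i+1)(j+1)}e_{i+j+2}$ if $i+j\le n-2$, and $e_i\diamond e_j=0$ otherwise. Then the space of derivations of $A$ is $$\mathfrak{Der}(A)=\langle\varphi,\ \phi_i,\ \psi_j,\ \pi_k : 0\le i\le 6,\ 0\le j\le 4,\ 0\le k\le 2\rangle,$$ where these linear maps are given on the basis (all values not listed being zero) by - $\varphi(e_i)=(i+2)e_i$ for $1\le i\le n$; - $\phi_6(e_1)=18(n-2)(n-5)e_{n-6}$, $\phi_6(e_2)=8(n-4)(n+3)e_{n-5}$, $\phi_6(e_3)=3(n-3)(n+18)e_{n-4}$, $\phi_6(e_4)=72(n-2)e_{n-3}$, $\phi_6(e_5)=60n\,e_{n-2}$, $\phi_6(e_6)=48(n+3)e_{n-1}$, $\phi_6(e_7)=36(n+8)e_n$; - $\phi_5(e_1)=2(n-4)e_{n-5}$, $\phi_5(e_3)=(2-n)e_{n-3}$, $\phi_5(e_4)=8e_{n-2}$, $\phi_5(e_5)=4e_{n-1}$; - $\phi_4(e_1)=(n-3)e_{n-4}$, $\phi_4(e_4)=4e_{n-1}$, $\phi_4(e_5)=2e_n$; - $\phi_3(e_1)=(n-2)e_{n-3}$, $\phi_3(e_4)=4e_n$; - $\phi_2(e_1)=e_{n-2}$; $\ \phi_1(e_1)=e_{n-1}$; $\ \phi_0(e_1)=e_n$; - $\psi_4(e_2)=2(n-3)e_{n-4}$,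 $\psi_4(e_3)=3(n-2)e_{n-3}$, $\psi_4(e_5)=6e_{n-1}$, $\psi_4(e_6)=12e_n$; - $\psi_3(e_2)=(n-2)e_{n-3}$, $\psi_3(e_5)=3e_n$; - $\psi_2(e_2)=e_{n-2}$; $\ \psi_1(e_2)=e_{n-1}$; $\ \psi_0(e_2)=e_n$; - $\pi_2(e_3)=e_{n-2}$; $\ \pi_1(e_3)=e_{n-1}$; $\ \pi_0(e_3)=e_n$.
   Context: A derivation of an algebra $(A,\diamond)$ is a linear map $D:A\to A$ with $D(a\diamond b)=D(a)\diamond b+a\diamond D(b)$ for all $a,b\in A$. $\langle S\rangle$ denotes the linear span of $S$ over $\mathbb C$. *)

(* Defs.v *)
From HB Require Import structures.
From mathcomp Require Import all_boot all_order all_algebra.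

Set Implicit Arguments.
Unset Strict Implicit.
Unset Printing Implicit Defensive.

Import GRing.Theory.
Local Open Scope ring_scope.

Section Defs.
Variables (F : fieldType) (n : nat).

Local Notation V := 'rV[F]_n.

(* Basis vectors are numbered from 1, so e k is the unit vector at position
   k - 1; e k = 0 when k = 0 or k > n. *)
Definition e (k : nat) : V := \row_(j < n) (j.+1 == k)%:R.

(* The product of e_i and e_j, for 1 <= i, j <= n. *)
Definition idd_basis_mul (i j : nat) : V :=
  if (i + j + 2 <= n)%N then ((i.+1)%:R * (j.+1)%:R)^-1 *: e (i + j + 2)
  else 0.

(* The ordinal i : 'I_n stands for the basis index i + 1. *)
Definition idd_mul (x y : V) : V :=
  \sum_(i < n) \sum_(j < n) (x 0 i * y 0 j) *: idd_basis_mul i.+1 j.+1.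

Definition is_derivation (mul : V -> V -> V) (D : 'End(V)) : Prop :=
  forall a b : V, D (mul a b) = mul (D a) b + mul a (D b).

(* The linear endomorphism sending e_k to f k for 1 <= k <= n: matrices act on
   row vectors from the right, so f k is row number k - 1. *)
Definition basis_map (f : nat -> V) : 'End(V) :=
  linfun (mulmxr (\matrix_(i < n) f i.+1) : V -> V).

Definition varphi : 'End(V) := basis_map (fun k => k.+2%:R *: e k).

Local Notation N := (n%:R : F).

Definition phi (i : nat) : 'End(V) := basis_map (fun k =>
  match i, k with
  | 6%N, 1%N => (18 * (N - 2) * (N - 5)) *: e (n - 6)
  | 6%N, 2%N => (8 * (N - 4) * (N + 3)) *: e (n - 5)
  | 6%N, 3%N => (3 * (N - 3) * (N + 18)) *: e (n - 4)
  | 6%N, 4%N => (72 * (N - 2)) *: e (n - 3)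
  | 6%N, 5%N => (60 * N) *: e (n - 2)
  | 6%N, 6%N => (48 * (N + 3)) *: e (n - 1)
  | 6%N, 7%N => (36 * (N + 8)) *: e n
  | 5%N, 1%N => (2 * (N - 4)) *: e (n - 5)
  | 5%N, 3%N => (2 - N) *: e (n - 3)
  | 5%N, 4%N => 8 *: e (n - 2)
  | 5%N, 5%N => 4 *: e (n - 1)
  | 4%N, 1%N => (N - 3) *: e (n - 4)
  | 4%N, 4%N => 4 *: e (n - 1)
  | 4%N, 5%N => 2 *: e n
  | 3%N, 1%N => (N - 2) *: e (n - 3)
  | 3%N, 4%N => 4 *: e n
  | 2%N, 1%N => e (n - 2)
  | 1%N, 1%N => e (n - 1)
  | 0%N, 1%N => e n
  | _, _ => 0
  end).

Definition psi (j : nat) : 'End(V) := basis_map (fun k =>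
  match j, k with
  | 4%N, 2%N => (2 * (N - 3)) *: e (n - 4)
  | 4%N, 3%N => (3 * (N - 2)) *: e (n - 3)
  | 4%N, 5%N => 6 *: e (n - 1)
  | 4%N, 6%N => 12 *: e n
  | 3%N, 2%N => (N - 2) *: e (n - 3)
  | 3%N, 5%N => 3 *: e n
  | 2%N, 2%N => e (n - 2)
  | 1%N, 2%N => e (n - 1)
  | 0%N, 2%N => e n
  | _, _ => 0
  end).

Definition pi_ (l : nat) : 'End(V) := basis_map (fun k =>
  match l, k with
  | 2%N, 3%N => e (n - 2)
  | 1%N, 3%N => e (n - 1)
  | 0%N, 3%N => e n
  | _, _ => 0
  end).

Definition der_generators : seq 'End(V) :=
  varphi :: [seq phi i | i <- iota 0 7] ++ [seq psi j | j <- iota 0 5]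
         ++ [seq pi_ l | l <- iota 0 3].

Lemma e_delta (i : 'I_n) : e i.+1 = delta_mx 0 i.
Proof. by apply/rowP=> j; rewrite !mxE eqSS eqxx. Qed.

Lemma idd_mul_e (i j : 'I_n) : idd_mul (e i.+1) (e j.+1) = idd_basis_mul i.+1 j.+1.
Proof.
rewrite /idd_mul (bigD1 i) //= [X in _ + X]big1 => [|k nki]; last first.
  apply: big1 => l _.
  by rewrite mxE eqSS (inj_eq val_inj) (negbTE nki) mul0r scale0r.
rewrite (bigD1 j) //= [X in _ + X + _]big1 => [|l nlj]; last first.
  by rewrite !mxE [l.+1 == _]eqSS (inj_eq val_inj) (negbTE nlj) mulr0 scale0r.
by rewrite !mxE !eqxx mulr1 scale1r !addr0.
Qed.

Lemma basis_map_e (f : nat -> V) (i : 'I_n) : basis_map f (e i.+1) = f i.+1.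
Proof. by rewrite /basis_map lfunE /= e_delta -rowE rowK. Qed.

End Defs.

Arguments der_generators : clear implicits.

(* Main.v *)
From HB Require Import structures.
Require Import Defs.
From mathcomp Require Import all_boot all_order all_algebra.
From mathcomp Require Import reals.
From mathcomp Require Import complex.
From mathcomp Require Import ring zify.

(** The algebra is graded by giving e_k the degree k + 2, so a derivation D
    splits into homogeneous parts, each mapping e_k to a multiple of e_(k+s)
    for a fixed shift s.  Let x(k, m) be the coefficient of e_m in D(e_k) and
    rescale it to w(k, m) = (k + 1) x(k, m) / (m + 1).  Comparing coefficients
    in the Leibniz rule for e_i and e_j gives, for every m <= n,
      x(i + j + 2, m) = w(i, m - j - 2) + w(j, m - i - 2)
    (derivation_ecoef), where a w whose target index is not positive is 0.

    In particular e_1, e_2, e_3 generate the algebra, and D is determined by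
    its values there (derivation_ext0).  These values are constrained by the
    fact that k can be written as i + j + 2 in several ways.  If p <= n - 7,
    all products giving e_4, ..., e_8 contribute a relation along the diagonal
    of x(1, p), and these relations force p (p - 1) x(1, p) = 0
    (derivation_e1_bulk).  Hence D(e_1) only involves e_1 and the last seven
    basis vectors.  Once D(e_1) = 0, fewer relations show that D(e_2) only
    involves the last five (derivation_e2_bulk), and once D(e_2) = 0 as well,
    D(e_3) only involves the last three (derivation_e3_bulk).  A derivation is
    therefore determined by 1 + 7 + 5 + 3 of its coefficients
    (derivation_rigid).

    The sixteen proposed generators are arranged so that these coefficients
    can be cleared one row after another: varphi handles x(1, 1), phi_i handles
    x(1, n - i), psi_j kills e_1 and handles x(2, n - j), and pi_l kills e_1
    and e_2 and handles x(3, n - l) (clear_row).  What remains of a derivation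
    after this subtraction is a derivation with all sixteen coefficients zero,
    hence zero.  Conversely, each generator is homogeneous, and the Leibniz
    rule for it reduces to finitely many polynomial identities in n
    (graded_derivation). *)

Set Implicit Arguments.
Unset Strict Implicit.
Unset Printing Implicit Defensive.
Import GRing.Theory Num.Theory.

Local Open Scope ring_scope.
Local Open Scope complex_scope.

(** * Coefficients and products of basis vectors *)

Section Coefficients.
Variables (F : fieldType) (n : nat).
Local Notation V := 'rV[F]_n.

(** Indexed by natural numbers, so that an index outside 1..n, such as one
    produced by a truncated subtraction, gives 0 and needs no case analysis. *)
Definition ecoef (m : nat) (v : V) : F := \sum_(j < n) (j.+1 == m)%:R * v 0 j.

Fact ecoef_is_linear m : scalar (ecoef m).
Proof.
move=> a u v; rewrite /ecoef mulr_sumr -big_split /=; apply: eq_bigr => j _.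
by rewrite !mxE mulrDr mulrCA.
Qed.

HB.instance Definition _ m :=
  GRing.isLinear.Build F V F _ (ecoef m) (ecoef_is_linear m).

Lemma ecoef_ord (j : 'I_n) (v : V) : ecoef j.+1 v = v 0 j.
Proof.
rewrite /ecoef (bigD1 j) //= eqxx mul1r big1 ?addr0 // => i nij.
by rewrite eqSS (inj_eq val_inj) (negbTE nij) mul0r.
Qed.

Lemma ecoef_out m (v : V) : ~~ (0 < m <= n)%N -> ecoef m v = 0.
Proof.
move=> out; apply: big1 => j _; case: eqP => [jm|_]; last by rewrite mul0r.
by case/negP: out; rewrite -jm ltn_ord.
Qed.

Lemma ecoef_inj (u v : V) :
  (forall m, (0 < m <= n)%N -> ecoef m u = ecoef m v) -> u = v.
Proof. by move=> uv; apply/rowP=> j; rewrite -!ecoef_ord uv ?ltn_ord. Qed.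

Lemma e_out k : ~~ (0 < k <= n)%N -> e F n k = 0.
Proof.
move=> out; apply/rowP=> j; rewrite !mxE; case: eqP => // jk.
by case/negP: out; rewrite -jk ltn_ord.
Qed.

Lemma ecoef_e m k : (0 < m <= n)%N -> ecoef m (e F n k) = (m == k)%:R.
Proof. by case: m => // m lt_mn; rewrite (ecoef_ord (Ordinal lt_mn)) mxE. Qed.

Lemma e_expand (v : V) : v = \sum_(j < n) v 0 j *: e F n j.+1.
Proof. by rewrite [LHS](row_sum_delta v); apply: eq_bigr => j _; rewrite e_delta. Qed.

(** A single formula covers all i and j because e_k = 0 for k > n. *)
Lemma idd_basis_mulE i j :
  idd_basis_mul F n i j = (i.+1%:R * j.+1%:R)^-1 *: e F n (i + j + 2).
Proof.
rewrite /idd_basis_mul; case: ifP => // lt; rewrite e_out ?scaler0 //.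
by rewrite lt andbF.
Qed.

Lemma idd_mulC (u v : V) : idd_mul u v = idd_mul v u.
Proof.
rewrite /idd_mul exchange_big /=; apply: eq_bigr => i _; apply: eq_bigr => j _.
by rewrite mulrC !idd_basis_mulE [X in X^-1]mulrC (addnC j.+1).
Qed.

Fact idd_mul_is_linear (u : V) : linear (idd_mul u).
Proof.
move=> a v w; rewrite /idd_mul scaler_sumr -big_split /=; apply: eq_bigr => i _.
rewrite scaler_sumr -big_split /=; apply: eq_bigr => j _.
by rewrite scalerA -scalerDl !mxE mulrDr mulrCA.
Qed.

HB.instance Definition _ u :=
  GRing.isLinear.Build F V V _ (idd_mul u) (idd_mul_is_linear u).

Lemma idd_mulDl (u v w : V) : idd_mul (u + v) w = idd_mul u w + idd_mul v w.
Proof. by rewrite !(idd_mulC _ w) linearD. Qed.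

Lemma idd_mulZl a (u v : V) : idd_mul (a *: u) v = a *: idd_mul u v.
Proof. by rewrite !(idd_mulC _ v) linearZ. Qed.

Lemma idd_mulZr a (u v : V) : idd_mul u (a *: v) = a *: idd_mul u v.
Proof. exact: linearZ. Qed.

Lemma idd_mul0l (v : V) : idd_mul 0 v = 0.
Proof. by rewrite idd_mulC linear0. Qed.

Lemma idd_mul_suml I (r : seq I) (f : I -> V) v :
  idd_mul (\sum_(i <- r) f i) v = \sum_(i <- r) idd_mul (f i) v.
Proof. by rewrite idd_mulC raddf_sum; apply: eq_bigr => i _; rewrite idd_mulC. Qed.

Lemma idd_mul_sumr I (r : seq I) (f : I -> V) v :
  idd_mul v (\sum_(i <- r) f i) = \sum_(i <- r) idd_mul v (f i).
Proof. exact: linear_sum. Qed.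

Lemma idd_mul_ee i j : (0 < i)%N -> (0 < j)%N ->
  idd_mul (e F n i) (e F n j) = (i.+1%:R * j.+1%:R)^-1 *: e F n (i + j + 2).
Proof.
case: i j => // i [] // j _ _.
have [lt_in|ge_in] := ltnP i n; last first.
  by rewrite (@e_out i.+1) ?(@e_out (_ + 2)) ?idd_mul0l ?scaler0 //; lia.
have [lt_jn|ge_jn] := ltnP j n; last first.
  by rewrite (@e_out j.+1) ?(@e_out (_ + 2)) ?linear0 ?scaler0 //; lia.
by rewrite (idd_mul_e _ (Ordinal lt_in) (Ordinal lt_jn)) idd_basis_mulE.
Qed.

(** When m <= j + 2 the truncated index is 0 and both sides vanish. *)
Lemma ecoef_mul_e m j (u : V) : (0 < j)%N -> (m <= n)%N ->
  ecoef m (idd_mul u (e F n j)) =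
    (j.+1%:R * (m - j - 2).+1%:R)^-1 * ecoef (m - j - 2) u.
Proof.
move=> j0 mn; rewrite [in LHS](e_expand u) idd_mul_suml linear_sum /=.
rewrite [in RHS]/ecoef mulr_sumr; apply: eq_bigr => i _.
rewrite idd_mulZl idd_mul_ee // !linearZ /=.
have [m0|m0] := posnP m.
  by rewrite m0 ecoef_out // !sub0n mul0r !mulr0.
rewrite ecoef_e ?m0 //; have [E|NE] := eqVneq (i.+1) (m - j - 2)%N.
  rewrite -E (_ : (m == _)); last by lia.
  by rewrite mulr1 mul1r mulrC [j.+1%:R * _]mulrC.
by rewrite (_ : (m == _) = false) ?mulr0 ?mul0r ?mulr0 //; lia.
Qed.

End Coefficients.

(** * Constructing derivations *)

Section Derivations.
Variables (F : numFieldType) (n : nat).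
Local Notation V := 'rV[F]_n.
Local Notation e := (e F n).
Local Notation is_der := (is_derivation (@idd_mul F n)).

Lemma derivation_linear a (D E : 'End(V)) : is_der D -> is_der E ->
  is_der (a *: D + E).
Proof.
move=> dD dE u v; rewrite !add_lfunE !scale_lfunE dD dE.
by rewrite [in RHS]linearD /= linearZ /= idd_mulDl idd_mulZl scalerDr addrACA.
Qed.

Lemma derivation0 : is_der 0.
Proof. by move=> u v; rewrite !zero_lfunE linear0 idd_mul0l addr0. Qed.

Lemma derivation_span (X : seq 'End(V)) :
  (forall D, D \in X -> is_der D) -> forall D, D \in <<X>>%VS -> is_der D.
Proof.
move=> derX D /(coord_span (X := in_tuple X)) ->.
elim/big_rec: _ => [|i E _ dE]; first exact: derivation0.
by apply: derivation_linear => //; apply: derX; rewrite mem_nth.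
Qed.

Lemma derivation_basis (D : 'End(V)) :
  (forall i j, (0 < i <= n)%N -> (0 < j <= n)%N -> D (idd_mul (e i) (e j)) =
     idd_mul (D (e i)) (e j) + idd_mul (e i) (D (e j))) -> is_der D.
Proof.
move=> derD u v.
have der_e (j : 'I_n) :
    D (idd_mul u (e j.+1)) = idd_mul (D u) (e j.+1) + idd_mul u (D (e j.+1)).
  rewrite (e_expand u) idd_mul_suml !(linear_sum D) /= !idd_mul_suml -big_split /=.
  apply: eq_bigr => i _.
  by rewrite idd_mulZl !linearZ /= !idd_mulZl derD ?ltn_ord // scalerDr.
rewrite (e_expand v) idd_mul_sumr !(linear_sum D) /= !idd_mul_sumr -big_split /=.
apply: eq_bigr => j _.
by rewrite idd_mulZr !linearZ /= der_e scalerDr.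
Qed.

Lemma basis_map_at (f : nat -> V) k : (0 < k <= n)%N ->
  basis_map f (e k) = f k.
Proof. by case: k => // k lt_kn; rewrite (basis_map_e _ (Ordinal lt_kn)). Qed.

(** For a map sending e_k to c_k e_(k+s), the Leibniz rule on e_i and e_j is one
    scalar equation, and it is void as soon as i + j + 2 + s > n because both
    sides are then multiples of a zero vector.  Denominators are cleared so
    that the condition is a polynomial identity. *)
Lemma graded_derivation (f : nat -> V) s :
    (forall k, (0 < k <= n)%N -> f k = ecoef (k + s) (f k) *: e (k + s)) ->
    (forall i j, (0 < i <= j)%N -> (i + j + 2 + s <= n)%N ->
       (i + s).+1%:R * (j + s).+1%:R * ecoef (i + j + 2 + s) (f (i + j + 2)%N)
       = i.+1%:R * (j + s).+1%:R * ecoef (i + s) (f i)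
         + j.+1%:R * (i + s).+1%:R * ecoef (j + s) (f j)) ->
  is_der (basis_map f).
Proof.
move=> homf relf.
have bmZ a v : basis_map f (a *: v) = a *: basis_map f v by exact: linearZ.
apply: derivation_basis => i j.
wlog le_ij: i j / (i <= j)%N => [th|] iP jP.
  have [/th|/ltnW/th] := leqP i j; first exact.
  by rewrite idd_mulC addrC [idd_mul (e j) _]idd_mulC [X in _ + X]idd_mulC; apply.
have [i0 j0] : (0 < i)%N /\ (0 < j)%N by lia.
rewrite !basis_map_at // homf // (homf j) // idd_mulZl idd_mulZr.
rewrite !idd_mul_ee ?addn_gt0 ?i0 ?j0 //.
rewrite bmZ (_ : (i + s + j + 2 = i + j + 2 + s)%N); last by lia.
rewrite (_ : (i + (j + s) + 2 = i + j + 2 + s)%N); last by lia.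
have [le_n|gt_n] := leqP (i + j + 2 + s) n; last first.
  have e0 : e (i + j + 2 + s) = 0 by apply: e_out; lia.
  rewrite e0 !scaler0 addr0; have [le_n|gt_n'] := leqP (i + j + 2) n.
    have ijP : (0 < i + j + 2 <= n)%N by lia.
    by rewrite basis_map_at // homf // e0 !scaler0.
  by rewrite (@e_out _ _ (i + j + 2)) ?linear0 ?scaler0 //; lia.
have ijP : (0 < i + j + 2 <= n)%N by lia.
rewrite basis_map_at // homf //.
rewrite !scalerA -scalerDl; congr (_ *: _).
have := relf i j; rewrite i0 le_ij le_n => /(_ isT isT) rel.
have nz k : k.+1%:R != 0 :> F by rewrite pnatr_eq0.
apply: (mulfI (mulf_neq0 (nz (i + s)%N) (nz (j + s)%N))).
rewrite mulrCA rel.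
have := nz i; have := nz j; have := nz (i + s)%N; have := nz (j + s)%N.
move: (i.+1%:R) (j.+1%:R) ((i + s).+1%:R) ((j + s).+1%:R) => a b c d *.
by field; rewrite ?mulf_neq0 //; do !(apply/andP; split).
Qed.

End Derivations.

(** * Derivations with vanishing coefficients *)

Section Rigidity.
Variables (F : numFieldType) (n : nat).
Local Notation V := 'rV[F]_n.
Local Notation e := (e F n).
Local Notation is_der := (is_derivation (@idd_mul F n)).

(** In D(e_k) e_j the coefficient of e_m is x(k, p) / ((p + 1) (j + 1)) for the
    p with p + j + 2 = m; multiplying by (k + 1) (j + 1), the normalization of
    e_k e_j, leaves exactly this quantity, which does not depend on j. *)
Definition wcoef (D : 'End(V)) (k m : nat) : F :=
  k.+1%:R / m.+1%:R * ecoef m (D (e k)).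

Lemma wcoef_eq0 (D : 'End(V)) k m :
  (wcoef D k m == 0) = (ecoef m (D (e k)) == 0).
Proof. by rewrite !mulf_eq0 invr_eq0 !pnatr_eq0. Qed.

Lemma ecoef_wcoef (D : 'End(V)) k m :
  ecoef m (D (e k)) = m.+1%:R / k.+1%:R * wcoef D k m.
Proof.
rewrite /wcoef mulrA mulf_div [X in X / _]mulrC divff ?mul1r //.
by rewrite mulf_neq0 ?pnatr_eq0.
Qed.

Lemma wcoef0 (D : 'End(V)) k : wcoef D k 0 = 0.
Proof. by apply/eqP; rewrite wcoef_eq0 ecoef_out. Qed.

Lemma derivation_ecoef (D : 'End(V)) i j m :
    is_der D -> (0 < i)%N -> (0 < j)%N -> (m <= n)%N ->
  ecoef m (D (e (i + j + 2))) = wcoef D i (m - j - 2) + wcoef D j (m - i - 2).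
Proof.
move=> derD i0 j0 mn; have nz k : k.+1%:R != 0 :> F by rewrite pnatr_eq0.
have := congr1 (ecoef m) (derD (e i) (e j)).
have DZ a v : D (a *: v) = a *: D v by exact: linearZ.
have cZ a (v : V) : ecoef m (a *: v) = a * ecoef m v by exact: linearZ.
have cD (u v : V) : ecoef m (u + v) = ecoef m u + ecoef m v by exact: linearD.
rewrite idd_mul_ee // DZ cZ cD [idd_mul (e i) _]idd_mulC !ecoef_mul_e //.
move=> /(congr1 ( *%R (i.+1%:R * j.+1%:R))); rewrite mulVKf ?mulf_neq0 // => ->.
rewrite mulrDr /wcoef; congr (_ + _); rewrite mulrA; congr (_ * _).
  by rewrite invfM mulrA mulfK.
by rewrite invfM mulrA [i.+1%:R * _]mulrC mulfK.
Qed.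

(** Up to a nonzero scalar, e_k is e_1 times e_(k-3) for every k >= 4, so
    e_1, e_2, e_3 generate the algebra. *)
Lemma derivation_ext0 (D : 'End(V)) : is_der D ->
  D (e 1) = 0 -> D (e 2) = 0 -> D (e 3) = 0 -> D = 0.
Proof.
move=> derD D1 D2 D3.
have De k : D (e k) = 0.
  elim/ltn_ind: k => -[|[|[|[|k]]]] IH //.
    by rewrite e_out ?linear0.
  apply: ecoef_inj => m /andP[_ mn]; rewrite linear0.
  have := derivation_ecoef (i := 1) (j := k.+1) derD isT isT mn.
  rewrite (_ : 1 + k.+1 + 2 = k.+4)%N; last by lia.
  move=> ->; rewrite /wcoef D1 IH; last by lia.
  by rewrite !linear0 !mulr0 addr0.
apply/lfunP=> v; rewrite zero_lfunE (e_expand v) linear_sum /= big1 // => j _.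
by rewrite linearZ /= De scaler0.
Qed.

Section Relations.
Variables (D : 'End(V)) (derD : is_der D).
Local Notation w := (wcoef D).

(** The indices k, p, q are separate variables so that the relation can be
    instantiated with them already in normal form. *)
Lemma derivation_wcoef i j k m p q : k = (i + j + 2)%N ->
    p = (m - j - 2)%N -> q = (m - i - 2)%N ->
    (0 < i)%N -> (0 < j)%N -> (m <= n)%N ->
  m.+1%:R * w k m = k.+1%:R * (w i p + w j q).
Proof.
move=> -> -> -> i0 j0 mn; rewrite -derivation_ecoef // ecoef_wcoef.
by rewrite [RHS]mulrA [X in _ = X * _]mulrCA divff ?mulr1 ?pnatr_eq0.
Qed.

(** Two ways of writing the same basis vector as a product. *)
Lemma derivation_wcoef_eq i j p q i' j' p' q' m : (i + j = i' + j')%N ->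
    (0 < i)%N -> (0 < j)%N -> (0 < i')%N -> (0 < j')%N -> (m <= n)%N ->
    p = (m - j - 2)%N -> q = (m - i - 2)%N ->
    p' = (m - j' - 2)%N -> q' = (m - i' - 2)%N ->
  w i p + w j q = w i' p' + w j' q'.
Proof.
move=> ij i0 j0 i0' j0' mn -> -> -> ->.
by rewrite -!derivation_ecoef // ij.
Qed.

(** Write a, b, c, d, f for w(1, p), w(2, p + 1), ..., w(5, p + 4).  The
    vectors e_6, e_7, e_8 are products in two ways each, which makes
    a, b, c, d, f an arithmetic progression.  The products e_1 e_1 and e_1 e_2
    express d and f through a and b once more, giving two linear equations in
    a and b whose determinant is p (p - 1). *)
Lemma derivation_e1_bulk p : (1 < p)%N -> (p + 7 <= n)%N -> w 1 p = 0.
Proof.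
move=> p1 pn.
have r4 : (p + 3).+1%:R * w 4 (p + 3) = 5%:R * (w 1 p + w 1 p).
  by apply: derivation_wcoef; lia.
have r5 : (p + 4).+1%:R * w 5 (p + 4) = 6%:R * (w 1 p + w 2 (p + 1)).
  by apply: derivation_wcoef; lia.
have r6 : w 1 p + w 3 (p + 2) = w 2 (p + 1) + w 2 (p + 1).
  by apply: (@derivation_wcoef_eq _ _ _ _ _ _ _ _ (p + 5)); lia.
have r7 : w 1 p + w 4 (p + 3) = w 2 (p + 1) + w 3 (p + 2).
  by apply: (@derivation_wcoef_eq _ _ _ _ _ _ _ _ (p + 6)); lia.
have r8 : w 1 p + w 5 (p + 4) = w 3 (p + 2) + w 3 (p + 2).
  by apply: (@derivation_wcoef_eq _ _ _ _ _ _ _ _ (p + 7)); lia.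
have tt : p%:R * (p%:R - 1) != 0 :> F.
  by rewrite mulf_neq0 ?subr_eq0 ?pnatr_eq0 ?(eqr_nat _ p 1); lia.
move: r4 r5 r6 r7 r8; rewrite -!natr1 !natrD.
move: (w 1 p) (w 2 _) (w 3 _) (w 4 _) (w 5 _) p%:R tt => a b c d f t tt.
move=> r4 r5 r6 r7 r8.
have Ec : c = b + b - a by rewrite -r6; ring.
have Ed : d = b + c - a by rewrite -r7; ring.
have Ef : f = c + c - a by rewrite -r8; ring.
rewrite {}Ef {}Ed {}Ec in r4 r5.
have r4' : 3 * (t + 4) * b = (2 * t + 18) * a.
  apply/eqP; rewrite -subr_eq0; move/eqP: r4; rewrite -subr_eq0 => /eqP <-.
  by apply/eqP; ring.
have r5' : (4 * t + 14) * b = (3 * t + 21) * a.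
  apply/eqP; rewrite -subr_eq0; move/eqP: r5; rewrite -subr_eq0 => /eqP <-.
  by apply/eqP; ring.
(* Eliminate b by Cramer's rule from r4' and r5'. *)
apply: (mulfI tt); rewrite mulr0.
have -> : t * (t - 1) * a = 3 * (t + 4) * ((3 * t + 21) * a)
    - (4 * t + 14) * ((2 * t + 18) * a) by ring.
by rewrite -r4' -r5'; ring.
Qed.

(** With w(1, _) = 0 the progression of derivation_e1_bulk starts at 0, so
    w(4, q + 2) is three times w(2, q), while it is 0 because e_4 is a multiple
    of the square of e_1. *)
Lemma derivation_e2_bulk q : (forall p, w 1 p = 0) -> (q + 5 <= n)%N -> w 2 q = 0.
Proof.
move=> w1 qn.
have r4 : (q + 2).+1%:R * w 4 (q + 2) = 5%:R * (w 1 (q - 1) + w 1 (q - 1)).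
  by apply: derivation_wcoef; lia.
have r6 : w 1 (q - 1) + w 3 (q + 1) = w 2 q + w 2 q.
  by apply: (@derivation_wcoef_eq _ _ _ _ _ _ _ _ (q + 4)); lia.
have r7 : w 1 (q - 1) + w 4 (q + 2) = w 2 q + w 3 (q + 1).
  by apply: (@derivation_wcoef_eq _ _ _ _ _ _ _ _ (q + 5)); lia.
have w4 : w 4 (q + 2) = 0.
  by apply/eqP; move/eqP: r4; rewrite !w1 addr0 mulr0 mulf_eq0 pnatr_eq0.
apply/eqP; move/eqP: r7; rewrite w4; move: r6; rewrite !w1 !add0r => ->.
by rewrite eq_sym -mulr2n -mulrS -mulr_natl mulf_eq0 pnatr_eq0.
Qed.

(** The vector e_6 is a multiple of both e_1 e_3 and e_2 e_2. *)
Lemma derivation_e3_bulk q : (forall p, w 1 p = 0) -> (forall p, w 2 p = 0) ->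
  (q + 3 <= n)%N -> w 3 q = 0.
Proof.
move=> w1 w2 qn.
have : w 1 (q - 2) + w 3 q = w 2 (q - 1) + w 2 (q - 1).
  by apply: (@derivation_wcoef_eq _ _ _ _ _ _ _ _ (q + 3)); lia.
by rewrite w1 !w2 !add0r.
Qed.

End Relations.

(** The bounds 7, 5, 3 are the numbers of phi_i, psi_j and pi_l.  The
    coefficient at (1, 1) is separate because the determinant p (p - 1) of
    derivation_e1_bulk vanishes for p = 1; it is the one that varphi moves. *)
Lemma derivation_rigid (D : 'End(V)) : is_der D ->
    ecoef 1 (D (e 1)) = 0 ->
    (forall p, (n < p + 7)%N -> (p <= n)%N -> ecoef p (D (e 1)) = 0) ->
    (forall p, (n < p + 5)%N -> (p <= n)%N -> ecoef p (D (e 2)) = 0) ->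
    (forall p, (n < p + 3)%N -> (p <= n)%N -> ecoef p (D (e 3)) = 0) ->
  D = 0.
Proof.
move=> derD c0 c1 c2 c3.
have w0 k p : ecoef p (D (e k)) = 0 -> wcoef D k p = 0.
  by move/eqP; rewrite -wcoef_eq0 => /eqP.
have out k p : (n < p)%N -> wcoef D k p = 0.
  by move=> np; apply/w0/ecoef_out; lia.
have w1 p : wcoef D 1 p = 0.
  have [/out//|pn] := ltnP n p; have [np|np] := ltnP n (p + 7); first exact/w0/c1.
  case: p pn np => [|[|p]] pn np; [exact: wcoef0 | exact: w0 |].
  exact: derivation_e1_bulk.
have w2 p : wcoef D 2 p = 0.
  have [/out//|pn] := ltnP n p; have [np|np] := ltnP n (p + 5); first exact/w0/c2.
  exact: derivation_e2_bulk.
have w3 p : wcoef D 3 p = 0.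
  have [/out//|pn] := ltnP n p; have [np|np] := ltnP n (p + 3); first exact/w0/c3.
  exact: derivation_e3_bulk.
have De0 k : (forall p, wcoef D k p = 0) -> D (e k) = 0.
  by move=> wk; apply: ecoef_inj => p _; rewrite ecoef_wcoef wk mulr0 linear0.
by apply: derivation_ext0; rewrite ?De0.
Qed.

End Rigidity.

(** * The generators are derivations *)

Section Generators.
Variables (F : numFieldType) (n : nat).
Hypothesis n8 : (8 <= n)%N.
Local Notation V := 'rV[F]_n.
Local Notation e := (e F n).
Local Notation is_der := (is_derivation (@idd_mul F n)).

Lemma ecoef_scale_e a m l : m = l -> (0 < m <= n)%N -> ecoef l (a *: e m) = a.
Proof. by move=> <- mn; rewrite linearZ /= ecoef_e // eqxx mulr1. Qed.

Lemma ecoef_e1 m l : m = l -> (0 < m <= n)%N -> ecoef l (e m) = 1.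
Proof. by move=> <- mn; rewrite ecoef_e // eqxx. Qed.

Lemma graded0 l : 0 = ecoef l (0 : V) *: e l.
Proof. by rewrite linear0 scale0r. Qed.

Lemma graded_scale_e a m l : m = l -> (0 < m <= n)%N ->
  a *: e m = ecoef l (a *: e m) *: e l.
Proof. by move=> <- mn; rewrite ecoef_scale_e. Qed.

Lemma graded_e m l : m = l -> (0 < m <= n)%N -> e m = ecoef l (e m) *: e l.
Proof. by move=> <- mn; rewrite ecoef_e1 ?scale1r. Qed.

(** Expresses n through the shift s = n - c, so that the identities to check
    become polynomial identities in the single variable s. *)
Lemma natr_split c : (c <= n)%N -> n%:R = (n - c)%:R + c%:R :> F.
Proof. by move=> cn; rewrite -natrD subnK. Qed.

Ltac graded_entry :=
  move=> ?;
  first [exact: graded0 | apply: graded_scale_e; lia | apply: graded_e; lia].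

(** A homogeneous map of shift n - c that kills e_k for k > 7 has a nontrivial
    Leibniz relation only when i + j + 2 <= c; with c <= 7 and i <= j this
    leaves i <= 2 and j <= 4. *)
Ltac graded_generator c :=
  apply: (@graded_derivation _ _ _ (n - c)) => [|];
  [ do 8 (case; [by graded_entry | ]); by move=> ? ?; exact: graded0
  | move=> [|[|[|?]]] [|[|[|[|[|?]]]]] ? ?; try (exfalso; lia);
    rewrite /= ?ecoef_scale_e ?ecoef_e1 ?linear0; try lia;
    rewrite ?(@natr_split c); try lia;
    rewrite -?[(_ + _).+1%:R]natr1 ?natrD; ring ].

Lemma derivation_varphi : is_der (varphi F n).
Proof.
apply: (@graded_derivation _ _ _ 0) => [k kn|i j ij ijn].
  by rewrite addn0; apply: graded_scale_e.
rewrite !ecoef_scale_e ?addn0 //; try lia.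
rewrite -!natr1 !natrD; ring.
Qed.

Lemma derivation_phi i : (i < 7)%N -> is_der (phi F n i).
Proof.
case: i => [|[|[|[|[|[|[|//]]]]]]] _.
- graded_generator 1%N.
- graded_generator 2%N.
- graded_generator 3%N.
- graded_generator 4%N.
- graded_generator 5%N.
- graded_generator 6%N.
- graded_generator 7%N.
Qed.

Lemma derivation_psi j : (j < 5)%N -> is_der (psi F n j).
Proof.
case: j => [|[|[|[|[|//]]]]] _.
- graded_generator 2%N.
- graded_generator 3%N.
- graded_generator 4%N.
- graded_generator 5%N.
- graded_generator 6%N.
Qed.

Lemma derivation_pi l : (l < 3)%N -> is_der (pi_ F n l).
Proof.
case: l => [|[|[|//]]] _.
- graded_generator 3%N.
- graded_generator 4%N.
- graded_generator 5%N.
Qed.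

Lemma derivation_generators D : D \in der_generators F n -> is_der D.
Proof.
rewrite inE !mem_cat => /predU1P[->|/or3P[]]; first exact: derivation_varphi.
- by case/mapP=> i; rewrite mem_iota => /derivation_phi di ->.
- by case/mapP=> j; rewrite mem_iota => /derivation_psi dj ->.
- by case/mapP=> l; rewrite mem_iota => /derivation_pi dl ->.
Qed.

End Generators.

(** * Subtracting generators *)

Section Elimination.
Variables (F : numFieldType) (n : nat).
Hypothesis n8 : (8 <= n)%N.
Local Notation V := 'rV[F]_n.
Local Notation e := (e F n).
Local Notation is_der := (is_derivation (@idd_mul F n)).

(** Since g_i(e_k) is a nonzero multiple of e_(n-i), the last r coefficients of
    D(e_k) can be cleared independently of each other. *)
Lemma clear_row (g : nat -> 'End(V)) k r (D : 'End(V)) : (r <= n)%N ->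
    (forall i, (i < r)%N -> exists2 c, c != 0 & g i (e k) = c *: e (n - i)) ->
  exists a : 'I_r -> F, forall p, (n < p + r)%N -> (p <= n)%N ->
    ecoef p ((D - \sum_i a i *: g i) (e k)) = 0.
Proof.
move=> rn lead.
pose c i := ecoef (n - i) (g i (e k)).
have gE i : (i < r)%N -> g i (e k) = c i *: e (n - i) /\ c i != 0.
  move=> ir; have [b b0 gb] := lead i ir.
  suff -> : c i = b by [].
  by rewrite /c gb linearZ /= ecoef_e ?eqxx ?mulr1 //; lia.
exists (fun i => ecoef (n - i) (D (e k)) / c i) => p np pn.
have ir : (n - p < r)%N by lia.
rewrite add_lfunE opp_lfunE sum_lfunE linearB linear_sum /=.
rewrite (bigD1 (Ordinal ir)) //= big1 => [|j].
  have [gEp c0] := gE _ ir.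
  rewrite scale_lfunE gEp scalerA divfK // linearZ /= subKn // ecoef_e; last by lia.
  by rewrite eqxx mulr1 addr0 subrr.
rewrite -val_eqE /= => jp; have [gEj _] := gE j (ltn_ord j).
rewrite scale_lfunE gEj !linearZ /= ecoef_e; last by lia.
rewrite (_ : (p == _) = false) ?mulr0 //.
by have := ltn_ord j; move: jp; lia.
Qed.

Lemma natrB_neq0 k : (k < n)%N -> n%:R - k%:R != 0 :> F.
Proof. by move=> kn; rewrite -natrB ?pnatr_eq0 ?subn_eq0 -?ltnNge // ltnW. Qed.

Lemma phi_e1 i : (i < 7)%N ->
  exists2 c : F, c != 0 & phi F n i (e 1) = c *: e (n - i).
Proof.
rewrite basis_map_at; last by lia.
have nz k : (0 < k < 8)%N -> n%:R - k%:R != 0 :> F.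
  by move=> ?; apply: natrB_neq0; lia.
have N2 := nz 2 isT; have N3 := nz 3 isT; have N4 := nz 4 isT; have N5 := nz 5 isT.
case: i => [|[|[|[|[|[|[|//]]]]]]] _ /=; rewrite ?subn0;
  try by [exists 1; rewrite ?oner_eq0 ?scale1r];
  by eexists; last reflexivity; rewrite ?mulf_neq0 ?pnatr_eq0.
Qed.

Lemma psi_e2 j : (j < 5)%N ->
  exists2 c : F, c != 0 & psi F n j (e 2) = c *: e (n - j).
Proof.
rewrite basis_map_at; last by lia.
have N2 : n%:R - 2 != 0 :> F by apply: (natrB_neq0 (k := 2)); lia.
have N3 : n%:R - 3 != 0 :> F by apply: (natrB_neq0 (k := 3)); lia.
case: j => [|[|[|[|[|//]]]]] _ /=; rewrite ?subn0;
  try by [exists 1; rewrite ?oner_eq0 ?scale1r];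
  by eexists; last reflexivity; rewrite ?mulf_neq0 ?pnatr_eq0.
Qed.

Lemma pi_e3 l : (l < 3)%N ->
  exists2 c : F, c != 0 & pi_ F n l (e 3) = c *: e (n - l).
Proof.
rewrite basis_map_at; last by lia.
by case: l => [|[|[|//]]] _ /=; exists 1; rewrite ?oner_eq0 ?scale1r ?subn0.
Qed.

Lemma psi_e1 j : psi F n j (e 1) = 0.
Proof. by rewrite basis_map_at; [case: j => [|[|[|[|[|]]]]] | lia]. Qed.

Lemma pi_e12 l : pi_ F n l (e 1) = 0 /\ pi_ F n l (e 2) = 0.
Proof. by rewrite !basis_map_at; try lia; case: l => [|[|[|]]]. Qed.

Lemma sub_comb_e r (g : nat -> 'End(V)) (a : 'I_r -> F) (D : 'End(V)) k :
  (forall i, g i (e k) = 0) -> (D - \sum_i a i *: g i) (e k) = D (e k).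
Proof.
move=> g0; rewrite add_lfunE opp_lfunE sum_lfunE big1 ?subr0 // => i _.
by rewrite scale_lfunE g0 scaler0.
Qed.

(** The three rows are cleared in the order e_1, e_2, e_3: the psi_j and pi_l
    subtracted later do not disturb the rows cleared before. *)
Lemma derivation_in_span (D : 'End(V)) :
  is_der D -> D \in <<der_generators F n>>%VS.
Proof.
move=> derD.
pose S := <<der_generators F n>>%VS.
have phiS i : (i < 7)%N -> phi F n i \in S.
  by move=> i7; rewrite memv_span // inE !mem_cat map_f ?orbT // mem_iota.
have psiS j : (j < 5)%N -> psi F n j \in S.
  by move=> j5; rewrite memv_span // inE !mem_cat (map_f (psi F n)) ?orbT // mem_iota.
have piS l : (l < 3)%N -> pi_ F n l \in S.
  by move=> l3; rewrite memv_span // inE !mem_cat (map_f (pi_ F n)) ?orbT // mem_iota.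
have combS r (g : nat -> 'End(V)) (a : 'I_r -> F) :
    (forall i, (i < r)%N -> g i \in S) -> \sum_i a i *: g i \in S.
  by move=> gS; apply: memv_suml => i _; rewrite memvZ ?gS.
pose G0 := (ecoef 1 (D (e 1)) / 3) *: varphi F n.
have G0S : G0 \in S by rewrite memvZ // memv_span // mem_head.
have [|a Ha] := @clear_row (phi F n) 1 7 (D - G0) _ phi_e1; first by lia.
set G1 := \sum_i a i *: _ in Ha.
have [|b Hb] := @clear_row (psi F n) 2 5 (D - G0 - G1) _ psi_e2; first by lia.
set G2 := \sum_i b i *: _ in Hb.
have [|c Hc] := @clear_row (pi_ F n) 3 3 (D - G0 - G1 - G2) _ pi_e3; first by lia.
set G3 := \sum_i c i *: _ in Hc.
have GS : G0 + G1 + G2 + G3 \in S by rewrite !memvD ?combS.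
suff D0 : D - G0 - G1 - G2 - G3 = 0.
  have -> : D = G0 + G1 + G2 + G3 by apply/eqP; rewrite -subr_eq0 !opprD !addrA D0.
  exact: GS.
have e1_23 : (D - G0 - G1 - G2 - G3) (e 1) = (D - G0 - G1) (e 1).
  rewrite (@sub_comb_e _ (pi_ F n)); last by move=> l; have [] := pi_e12 l.
  by rewrite (@sub_comb_e _ (psi F n)) // => j; apply: psi_e1.
apply: derivation_rigid => [||p np pn|p np pn|p np pn]; last exact: Hc.
- rewrite -!addrA -!opprD !addrA -scaleN1r addrC.
  apply: derivation_linear => //.
  exact: derivation_span (derivation_generators n8) _ GS.
- rewrite e1_23 add_lfunE opp_lfunE sum_lfunE linearB linear_sum /= big1 => [|i _].
    rewrite subr0 add_lfunE opp_lfunE scale_lfunE basis_map_at; last by lia.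
    rewrite linearB !linearZ /= ecoef_e; last by lia.
    by rewrite eqxx mulr1 divfK ?subrr ?pnatr_eq0.
  have [x _ gx] := phi_e1 (ltn_ord i).
  rewrite scale_lfunE gx !linearZ /= ecoef_e; last by lia.
  rewrite (_ : (1%N == _) = false) ?mulr0 //.
  by have := ltn_ord i; lia.
- by rewrite e1_23 Ha.
- by rewrite (@sub_comb_e _ (pi_ F n)) ?Hb // => l; have [] := pi_e12 l.
Qed.

End Elimination.

Theorem theorem4p25 (R : realType) (n : nat) (hn : (8 <= n)%N)
    (D : 'End('rV[R[i]]_n)) :
  is_derivation (@idd_mul R[i] n) D <-> D \in <<der_generators R[i] n>>%VS.
Proof.
split; first exact: derivation_in_span.
exact: derivation_span (derivation_generators hn) D.
Qed.
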